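(* Let $F_2 = \langle x, y \rangle$ be the free group on $x,y$, let $\theta$ be the automorphism of $F_2$ that interchanges $x$ and $y$, and let $H_0 \leq F_2$ be the kernel of the homomorphism $F_2 \to \mathbb{Z}_2 = \langle \theta \rangle$ given by $x \mapsto \theta$, $y \mapsto \theta$. Define an operation $\circ$ on $F_2$ by $$a \circ b = \begin{cases} ab, & \text{if } a \in H_0,\ b \in F_2,\\ a\,\theta(b), & \text{if } a \notin H_0,\ b \in F_2.\end{cases}$$ Then $(F_2, \cdot, \circ)$ is a skew left brace and $(F_2, \circ)$ is a free group of rank $2$.
   Context: A skew left brace is a triple $(G, \cdot, \circ)$ where $(G,\cdot)$ and $(G,\circ)$ are groups and $g_1 \circ (g_2 \cdot g_3) = (g_1 \circ g_2)\cdot g_1^{-1} \cdot (g_1 \circ g_3)$ for all $g_1,g_2,g_3 \in G$, where $g_1^{-1}$ is the inverse in $(G,\cdot)$. Here $\cdot$ is the usual multiplication of $F_2$. *)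

(* Defs.v *)
From HB Require Import structures.
From mathcomp Require Import all_boot all_order all_algebra all_fingroup.

Set Implicit Arguments.
Unset Strict Implicit.
Unset Printing Implicit Defensive.

(* Group laws are given as bare operations, because the same carrier is
   considered with two of them. *)
Definition is_group (T : Type) (op : T -> T -> T) : Prop :=
  exists (e : T) (inv : T -> T),
    [/\ associative op, left_id e op, right_id e op,
        left_inverse e inv op & right_inverse e inv op].

(* The universal property of the free group on the family b. Test groups are
   arbitrary (possibly infinite) groups; maps preserving products between
   groups are automatically group homomorphisms. *)
Definition is_free_basis (T : Type) (op : T -> T -> T)
    (I : Type) (b : I -> T) : Prop :=
  forall (K : groupType) (k : I -> K),
    exists f : T -> K,
      [/\ {morph f : u v / op u v >-> (u * v)%g},
          forall i, f (b i) = k i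
        & forall g : T -> K,
            {morph g : u v / op u v >-> (u * v)%g} ->
            (forall i, g (b i) = k i) -> g =1 f].

Definition is_free_group_on (T : Type) (op : T -> T -> T)
    (I : Type) (b : I -> T) : Prop :=
  is_group op /\ is_free_basis op b.

Definition is_free_group_of_rank (n : nat) (T : Type) (op : T -> T -> T)
    : Prop :=
  exists b : 'I_n -> T, is_free_group_on op b.

Definition is_skew_left_brace (G : groupType) (circ : G -> G -> G) : Prop :=
  is_group circ /\
  forall g1 g2 g3 : G,
    circ g1 (g2 * g3)%g = (circ g1 g2 * g1^-1 * circ g1 g3)%g.

(* H0 is the kernel of phi, whose target is the additive group of integers
   modulo 2. *)
Definition twisted_op (F : groupType) (theta : F -> F) (phi : F -> 'Z_2)
    (a b : F) : F :=
  if phi a == 0%R then (a * b)%g else (a * theta b)%g.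

(* Main.v *)
(** Every homomorphism from the twisted group is the first coordinate of an
    ordinary homomorphism.  If [f] preserves the twisted law, then
    [a |-> ((f a, f (theta a)), phi a)] is a homomorphism from [F] to the
    wreath product of the target with [Z/2]; conversely, a homomorphism [h] from
    [F] to the wreath product with [h x = ((k0, k1), 1)] and
    [h y = ((k1, k0), 1)] intertwines [theta] with the swap of coordinates, and
    therefore its first coordinate preserves the twisted law.  So [x, y] is a
    free basis for the twisted law too. *)

Require Import Defs.
From HB Require Import structures.
From mathcomp Require Import all_boot all_order all_algebra all_fingroup.

Set Implicit Arguments.
Unset Strict Implicit.
Unset Printing Implicit Defensive.

Lemma Z2_cases (i : 'Z_2) : i = 0%R \/ i = 1%R.
Proof. by case: i => [[|[|]]] // lt_i; [left | right]; apply: val_inj. Qed.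

Section WreathProduct.
Variable K : groupType.
Local Open Scope group_scope.

Definition wreath2 : Type := (K * K * 'Z_2)%type.
HB.instance Definition _ := Choice.on wreath2.

Definition swap_if (i : 'Z_2) (p : K * K) : K * K :=
  if i == 0%R then p else (p.2, p.1).

Definition wreath2_one : wreath2 := ((1, 1), 0%R).
Definition wreath2_mul (u v : wreath2) : wreath2 :=
  let q := swap_if u.2 v.1 in ((u.1.1 * q.1, u.1.2 * q.2), (u.2 + v.2)%R).
Definition wreath2_inv (u : wreath2) : wreath2 :=
  (swap_if u.2 (u.1.1^-1, u.1.2^-1), (- u.2)%R).

Fact wreath2_mulA : associative wreath2_mul.
Proof.
move=> [[a b] i] [[c d] j] [[e f] k]; rewrite /wreath2_mul /swap_if /= GRing.addrA.
by case: (Z2_cases i) => ->; case: (Z2_cases j) => ->; rewrite /= !mulgA.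
Qed.

Fact wreath2_mul1g : left_id wreath2_one wreath2_mul.
Proof. by case=> [[a b] i]; rewrite /wreath2_mul /= !mul1g GRing.add0r. Qed.

Fact wreath2_mulg1 : right_id wreath2_one wreath2_mul.
Proof.
case=> [[a b] i]; rewrite /wreath2_mul /swap_if /= GRing.addr0.
by case: ifP; rewrite /= !mulg1.
Qed.

Fact wreath2_mulVg : left_inverse wreath2_one wreath2_inv wreath2_mul.
Proof.
case=> [[a b] i]; rewrite /wreath2_mul /wreath2_inv /swap_if /= GRing.addNr.
by case: (Z2_cases i) => ->; rewrite /= !mulVg.
Qed.

Fact wreath2_mulgV : right_inverse wreath2_one wreath2_inv wreath2_mul.
Proof.
case=> [[a b] i]; rewrite /wreath2_mul /wreath2_inv /swap_if /= GRing.subrr.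
by case: (Z2_cases i) => ->; rewrite /= !mulgV.
Qed.

HB.instance Definition _ := isGroup.Build wreath2
  wreath2_mulA wreath2_mul1g wreath2_mulg1 wreath2_mulVg wreath2_mulgV.

(** This is conjugation by [((1, 1), 1)], so it is an inner automorphism. *)
Definition wreath2_swap (u : wreath2) : wreath2 := ((u.1.2, u.1.1), u.2).

Lemma wreath2_swapM : {morph wreath2_swap : u v / u * v}.
Proof.
move=> [[a b] i] [[c d] j]; rewrite /mul /= /wreath2_mul /wreath2_swap /=.
by rewrite /swap_if /=; case: ifP.
Qed.

End WreathProduct.

(** Both maps extend the family [g \o b], so the uniqueness clause identifies them. Later identities
    between homomorphisms out of [F] thus reduce to a check on [x] and [y]. *)
Lemma free_basis_ext (F : groupType) (I : Type) (b : I -> F) (K : groupType)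
    (f g : F -> K) :
  is_free_basis (fun u v : F => (u * v)%g) b ->
  {morph f : u v / (u * v)%g} -> {morph g : u v / (u * v)%g} ->
  (forall i, f (b i) = g (b i)) -> f =1 g.
Proof.
move=> free_b fM gM eq_fg u.
have [h [_ _ h_uniq]] := free_b K (g \o b).
by rewrite (h_uniq f fM) // (h_uniq g gM).
Qed.

Lemma group_morph1 (F K : groupType) (f : F -> K) :
  {morph f : u v / (u * v)%g} -> f 1%g = 1%g.
Proof. by move=> fM; apply: (mulIg (f 1%g)); rewrite -fM !mul1g. Qed.

Section TwistedOperation.
Variables (F : groupType) (theta : F -> F) (phi : F -> 'Z_2).
Hypothesis theta_morph : {morph theta : a b / (a * b)%g}.
Hypothesis phi_morph : {morph phi : a b / (a * b)%g >-> (a + b)%R}.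
Hypothesis thetaK : involutive theta.
Hypothesis phi_theta : forall a, phi (theta a) = phi a.
Local Notation circ := (twisted_op theta phi).

Lemma phi_twisted a b : phi (circ a b) = (phi a + phi b)%R.
Proof. by rewrite /twisted_op; case: ifP; rewrite phi_morph ?phi_theta. Qed.

Lemma theta_twisted a b : theta (circ a b) = circ (theta a) (theta b).
Proof. by rewrite /twisted_op phi_theta; case: ifP; rewrite theta_morph. Qed.

(** Write [circ a b] as a·θ^i(b) with i = [phi a], and let j = [phi b]. Both bracketings then equal
    a·θ^i(b)·θ^(i+j)(c); for i = j = 1 this uses θ² = id. *)
Lemma twisted_op_assoc : associative circ.
Proof.
move=> a b c; rewrite {1}/twisted_op [RHS]/twisted_op phi_twisted theta_twisted.
rewrite /twisted_op phi_theta.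
by case: (Z2_cases (phi a)) => ->; case: (Z2_cases (phi b)) => ->;
  rewrite /= ?thetaK mulgA.
Qed.

Lemma twisted_op_group : is_group circ.
Proof.
have theta1 := group_morph1 theta_morph.
(* Here ['Z_2] is used as a group whose product is addition and whose unit is 0. *)
have phi1 : phi 1%g = 0%R := group_morph1 phi_morph.
have phiV a : phi a^-1%g = phi a.
  have: (phi a + phi a^-1%g = 0)%R by rewrite -phi_morph mulgV.
  by case: (Z2_cases (phi a)) => ->; case: (Z2_cases (phi a^-1%g)) => ->.
(* The inverse solves a·θ^i(b) = 1 with i = [phi a], which gives b = θ^i(a⁻¹). *)
exists 1%g, (fun a => if phi a == 0%R then a^-1%g else theta a^-1%g).
split.
- exact: twisted_op_assoc.
- by move=> a; rewrite /twisted_op phi1 mul1g.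
- by move=> a; rewrite /twisted_op theta1 !mulg1 if_same.
- move=> a; rewrite /twisted_op; case phi_a: (phi a == 0%R).
    by rewrite phiV phi_a mulVg.
  by rewrite phi_theta phiV phi_a -theta_morph mulVg theta1.
- move=> a; rewrite /twisted_op.
  by case: (phi a == 0%R); rewrite ?thetaK mulgV.
Qed.

(** For fixed a, the map b ↦ a⁻¹·(a ∘ b) is the identity or θ, hence multiplicative; this is the
    brace identity. *)
Lemma twisted_op_brace : is_skew_left_brace circ.
Proof.
split; first exact: twisted_op_group.
move=> a b c; rewrite /twisted_op.
by case: ifP; rewrite ?theta_morph !mulgA mulgKV.
Qed.

End TwistedOperation.

Theorem proposition3p10 (F : groupType) (x y : F)
    (F_free : is_free_group_on (fun a b : F => (a * b)%g) (tnth [tuple x; y]))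
    (theta : F -> F)
    (theta_morph : {morph theta : a b / (a * b)%g})
    (theta_bij : bijective theta)
    (theta_x : theta x = y) (theta_y : theta y = x)
    (phi : F -> 'Z_2)
    (phi_morph : {morph phi : a b / (a * b)%g >-> (a + b)%R})
    (phi_x : phi x = 1%R) (phi_y : phi y = 1%R) :
  is_skew_left_brace (twisted_op theta phi) /\
  is_free_group_of_rank 2 (twisted_op theta phi).
Proof.
have [_ basis] := F_free.
have ord2P (P : 'I_2 -> Prop) : P ord0 -> P (inord 1) -> forall i, P i.
  move=> P0 P1 [[|[|]] // lt_i].
    by rewrite (_ : Ordinal _ = ord0) //; apply: val_inj.
  by rewrite (_ : Ordinal _ = inord 1) //; apply: val_inj; rewrite /= inordK.
have b0 : tnth [tuple x; y] ord0 = x by [].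
have b1 : tnth [tuple x; y] (inord 1) = y by rewrite (tnth_nth x) /= inordK.
have ext (K : groupType) (f g : F -> K) :
    {morph f : u v / (u * v)%g} -> {morph g : u v / (u * v)%g} ->
    f x = g x -> f y = g y -> f =1 g.
  move=> fM gM fgx fgy; apply: (free_basis_ext basis) => //.
  by apply: ord2P; rewrite ?b0 ?b1.
have thetaK : involutive theta.
  apply: (ext F (theta \o theta) id) => //=; rewrite ?theta_x ?theta_y //.
  by move=> a b /=; rewrite !theta_morph.
have phi_theta a : phi (theta a) = phi a.
  apply: (ext _ (phi \o theta) phi) => //=; rewrite ?theta_x ?theta_y ?phi_x //.
  by move=> u v /=; rewrite theta_morph phi_morph.
split; first exact: twisted_op_brace.
exists (tnth [tuple x; y]); split; first exact: twisted_op_group.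
move=> K k; set k0 := k ord0; set k1 := k (inord 1).
pose w i : wreath2 K :=
  if i == ord0 :> 'I_2 then ((k0, k1), 1%R) else ((k1, k0), 1%R).
have [h [hM h_basis _]] := basis _ w.
have hx : h x = ((k0, k1), 1%R) by rewrite -b0 h_basis.
have hy : h y = ((k1, k0), 1%R).
  by rewrite -b1 h_basis /w -val_eqE /= inordK.
have h_phi a : (h a).2 = phi a.
  apply: (ext _ (fun a => (h a).2) phi) => //; rewrite ?hx ?hy //.
  by move=> u v; rewrite hM.
have h_theta a : h (theta a) = wreath2_swap (h a).
  apply: (ext _ (h \o theta) (@wreath2_swap K \o h)) => /=.
  - by move=> u v /=; rewrite theta_morph hM.
  - by move=> u v /=; rewrite hM wreath2_swapM.
  - by rewrite theta_x hx hy.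
  - by rewrite theta_y hx hy.
exists (fun a => (h a).1.1); split.
- move=> a b; rewrite /twisted_op -h_phi.
  (* When [phi a] is 1, the product in the wreath product picks the second coordinate of [h b],
     which by [h_theta] is the first coordinate of [h (theta b)]. *)
  by case: ifP => h_a; rewrite hM ?h_theta /= /swap_if h_a.
- by apply: ord2P; rewrite ?b0 ?b1 ?hx ?hy.
move=> g gM g_basis.
have gx : g x = k0 by rewrite -b0 g_basis.
have gy : g y = k1 by rewrite -b1 g_basis.
(* Uniqueness: the homomorphism built from [g] agrees with [h] on [x] and [y], so [g] must be the
   first coordinate of [h]. *)
suff gh a : ((g a, g (theta a)), phi a) = h a by move=> a; rewrite -gh.
apply: (ext (wreath2 K) (fun a => ((g a, g (theta a)), phi a)) h) => //.
- move=> u v.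
  (* Since θ is an involution, the ordinary product is recovered from the twisted one: s·t = s ∘
     θ^i(t) with i = [phi s]. *)
  have g_dot s t :
      g (s * t)%g = (g s * g (if phi s == 0%R then t else theta t))%g.
    by rewrite -gM /twisted_op; case: (phi s == 0%R); rewrite ?thetaK.
  rewrite theta_morph !g_dot phi_theta phi_morph.
  rewrite [RHS]/mul /= /wreath2_mul /swap_if /=.
  by case: (phi u == 0%R); rewrite /= ?thetaK.
- by rewrite theta_x gx gy phi_x hx.
- by rewrite theta_y gx gy phi_y hy.
Qed.
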